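(* Let $\mathcal{A}\in\mathrm{S}(m,2)$ with $\mathrm{Sym}(\mathcal{A})=2$. If $\mathcal{A}$ is a $\mathrm{Q}$-tensor, then $\mathcal{A}$ is an $\mathrm{R}_0$-tensor.
   Context: $[n]=\{1,\dots,n\}$. $\mathrm{T}(m,n)$ is the set of all real tensors $\mathcal{A}=(a_{i_1 i_2\dots i_m})$, $i_1,\dots,i_m\in[n]$, of order $m$ and dimension $n$; $\mathrm{S}(m,n)\subset\mathrm{T}(m,n)$ is the set of symmetric tensors, i.e. those whose entries are invariant under any permutation of the indices. For $\mathbf{u}\in\mathbb{R}^n$, $\mathcal{A}\mathbf{u}^{m-1}\in\mathbb{R}^n$ is the vector with components $(\mathcal{A}\mathbf{u}^{m-1})_i=\sum_{i_2,\dots,i_m=1}^n a_{i i_2\dots i_m}u_{i_2}\cdots u_{i_m}$. For a vector $\mathbf{x}$, $\mathbf{x}\ge\mathbf{0}$ means every component is nonnegative. For $\mathbf{q}\in\mathbb{R}^n$, the tensor complementarity problem $\mathrm{TCP}(\mathcal{A},\mathbf{q})$ is to find $\mathbf{u}\in\mathbb{R}^n$ with $\mathbf{u}\ge\mathbf{0}$, $\mathcal{A}\mathbf{u}^{m-1}+\mathbf{q}\ge\mathbf{0}$ and $\mathbf{u}^T(\mathcal{A}\mathbf{u}^{m-1}+\mathbf{q})=0$; such a $\mathbf{u}$ is called a solution. $\mathcal{A}$ is a $\mathrm{Q}$-tensor if $\mathrm{TCP}(\mathcal{A},\mathbf{q})$ has a solution for every $\mathbf{q}\in\mathbb{R}^n$.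 $\mathcal{A}$ is an $\mathrm{R}_0$-tensor if $\mathbf{0}$ is the only solution of $\mathrm{TCP}(\mathcal{A},\mathbf{0})$. For $\mathbf{w}\in\mathbb{R}^n$, $[\mathbf{w}]^{\otimes m}\in\mathrm{S}(m,n)$ is the tensor with entries $w_{i_1}w_{i_2}\cdots w_{i_m}$. Every $\mathcal{A}\in\mathrm{S}(m,n)$ is a finite linear combination of tensors of this form, and its symmetric rank is $\mathrm{Sym}(\mathcal{A})=\min\{r:\mathcal{A}=\sum_{j=1}^r\mu_j[\mathbf{w}^{(j)}]^{\otimes m},\ \mu_j\in\mathbb{R},\ \mathbf{w}^{(j)}\in\mathbb{R}^n\}$. *)

(* Defs.v *)
From HB Require Import structures.
From mathcomp Require Import all_boot all_order all_algebra all_fingroup.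
From mathcomp Require Import reals.

Set Implicit Arguments.
Unset Strict Implicit.
Unset Printing Implicit Defensive.

Import Order.TTheory GRing.Theory Num.Theory.
Local Open Scope ring_scope.

(* The indices 1, ..., n are represented by the ordinals 0, ..., n-1. *)
Definition tensor (R : realType) (m n : nat) : Type :=
  {ffun m.-tuple 'I_n -> R}.

Definition symmetric_tensor (R : realType) (m n : nat) (A : tensor R m n) :
    Prop :=
  forall (s : 'S_m) (t : m.-tuple 'I_n), A [tuple tnth t (s k) | k < m] = A t.

(* A u^{m-1} only makes sense for order at least 1, so here m.+1 is the order
   of A and the remaining m indices are contracted with u. *)
Definition tensor_app (R : realType) (m n : nat) (A : tensor R m.+1 n)
    (u : 'cV[R]_n) : 'cV[R]_n :=
  \col_(i < n) \sum_(t : m.-tuple 'I_n)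
    A [tuple of i :: t] * \prod_(k < m) u (tnth t k) 0.

Definition nonneg_vec (R : realType) (n : nat) (x : 'cV[R]_n) : Prop :=
  forall i : 'I_n, 0 <= x i 0.

Definition TCP_solution (R : realType) (m n : nat) (A : tensor R m.+1 n)
    (q u : 'cV[R]_n) : Prop :=
  [/\ nonneg_vec u,
      nonneg_vec (tensor_app A u + q)
    & u^T *m (tensor_app A u + q) = 0].

Definition Q_tensor (R : realType) (m n : nat) (A : tensor R m.+1 n) : Prop :=
  forall q : 'cV[R]_n, exists u : 'cV[R]_n, TCP_solution A q u.

Definition R0_tensor (R : realType) (m n : nat) (A : tensor R m.+1 n) : Prop :=
  forall u : 'cV[R]_n, TCP_solution A 0 u <-> u = 0.

Definition tensor_pow (R : realType) (m n : nat) (w : 'cV[R]_n) :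
    tensor R m n :=
  [ffun t : m.-tuple 'I_n => \prod_(k < m) w (tnth t k) 0].

Definition sym_decomposable (R : realType) (m n : nat) (A : tensor R m n)
    (r : nat) : Prop :=
  exists (mu : 'I_r -> R) (w : 'I_r -> 'cV[R]_n),
    A = [ffun t => \sum_(j < r) mu j * tensor_pow m (w j) t].

(* Sym(A) = r: r is the least length of a symmetric decomposition. *)
Definition sym_rank_eq (R : realType) (m n : nat) (A : tensor R m n)
    (r : nat) : Prop :=
  sym_decomposable A r /\
  (forall s : nat, sym_decomposable A s -> (r <= s)%N).

(* Main.v *)
(** For [A] of order [m + 1], write
    [A u^m = alpha (a.u)^m a + beta (b.u)^m b], where rank two makes [a], [b]
    independent and [alpha], [beta] nonzero, so that [A u^m = 0] only for
    [u = 0]. A nonzero solution of TCP(A, 0) is then a positive multiple of a basis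
    vector, say of [e_1], and [A e_1^m = (0, c)] with [c > 0]. Rescaling [a]
    and [b] to have first coordinate 1 gives
    [A u^m = alpha (x^m - y^m, a x^m - b y^m)] with [x = u_1 + a u_2],
    [y = u_1 + b u_2] and, up to exchanging the two summands, [alpha > 0] and
    [a > b]. An explicit [q] without solution exists: [(-1/(1+|a|), 1)] if [m]
    is even; if [m] is odd, [(-1, 1)] when [a + b >= 0] and [(1, -1)]
    otherwise. *)
Require Import Defs.
From mathcomp Require Import all_boot all_order all_algebra all_fingroup.
From mathcomp Require Import reals.
From mathcomp Require Import ring lra.

Set Implicit Arguments.
Unset Strict Implicit.
Unset Printing Implicit Defensive.

Import Order.TTheory GRing.Theory Num.Theory.
Local Open Scope ring_scope.

(** * Scalar complementarity and inequalities between powers *)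

Definition compl (R : realFieldType) (u v : R) : Prop :=
  [/\ 0 <= u, 0 <= v & u * v = 0].

Lemma ler_Xodd (R : realDomainType) (m : nat) (x y : R) :
  odd m -> x <= y -> x ^+ m <= y ^+ m.
Proof.
move=> mo le_xy; have [x0|x0] := lerP 0 x.
  by apply: lerXn2r; rewrite // nnegrE (le_trans x0).
have [y0|y0] := lerP 0 y.
  by rewrite (@le_trans _ _ 0) ?exprn_odd_le0 ?exprn_odd_ge0 // ltW.
have: (- y) ^+ m <= (- x) ^+ m by apply: lerXn2r; rewrite ?nnegrE; lra.
by rewrite (exprNn x) (exprNn y) -signr_odd mo expr1 !mulN1r lerN2.
Qed.

Lemma ler_norm_X (R : realDomainType) (m : nat) (x y : R) :
  `|y| <= x -> `|y ^+ m| <= x ^+ m.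
Proof.
move=> le_yx; rewrite normrX lerXn2r ?nnegrE //.
exact: le_trans le_yx.
Qed.

Lemma compl_pos (R : realFieldType) (u v : R) : compl u v -> 0 < u -> v = 0.
Proof. by case=> _ _ /eqP; rewrite mulf_eq0 => /orP[]/eqP-> //; rewrite ltxx. Qed.

(** * Complementarity systems for a sum of two powers of linear forms *)

Lemma no_solution_even (R : realFieldType) (m : nat) (c a b u1 u2 : R) :
    (0 < m)%N -> ~~ odd m -> 0 < c -> b < a ->
    let X := (u1 + a * u2) ^+ m in let Y := (u1 + b * u2) ^+ m in
  compl u1 (c * (X - Y) - (1 + `|a|)^-1) -> ~ compl u2 (c * (a * X - b * Y) + 1).
Proof.
move=> m0 me c0 ltba X Y C1 C2.
have Y0 : 0 <= Y by apply: exprn_even_ge0.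
have cY0 : 0 <= c * (a - b) * Y by rewrite !mulr_ge0 // ?subr_ge0 ltW.
have d0 : 0 < (1 + `|a|)^-1 by rewrite invr_gt0 ltr_pwDl.
have [u10 F1ge _] := C1; have [u20 _ _] := C2.
(* With [u2 = 0] one has [X = Y], and the first complementarity value would be -1/(1+|a|) < 0. *)
have u2pos : 0 < u2.
  rewrite lt_neqAle u20 andbT; apply/eqP => E.
  by move: F1ge; rewrite /X /Y -E !mulr0 subrr mulr0; lra.
have F2E := compl_pos C2 u2pos.
(* [F2 = a F1 + c (a - b) Y], whence [a F1 <= -1] *)
have aF1 : a * (c * (X - Y)) <= -1 by lra.
have [a0|a0] := lerP 0 a.
  have : 0 <= a * (c * (X - Y)) by apply: mulr_ge0 => //; lra.
  lra.
(* Now [a < 0]. If [u1 > 0], then c(X - Y) = 1/(1+|a|), a constant chosen so that its product with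
   [a] stays above -1. If [u1 = 0], then b < a < 0 and the even exponent give X <= Y, although c(X -
   Y) must be positive. *)
have [u1pos|u1le] := ltrP 0 u1.
  have F1E := compl_pos C1 u1pos.
  have {F1E}F1E : c * (X - Y) = (1 + `|a|)^-1 by lra.
  move: aF1; rewrite F1E ltr0_norm // ler_pdivrMr; lra.
have u1E : u1 = 0 by apply/le_anti; rewrite u1le.
have : X <= Y.
  have le : `|a * u2| <= - (b * u2).
    by rewrite normrM ltr0_norm // gtr0_norm // -mulNr ler_wpM2r //; lra.
  rewrite /X /Y u1E !add0r (le_trans (ler_norm _)) //.
  rewrite (le_trans (ler_norm_X _ le)) // (exprNn (b * u2)).
  by rewrite -signr_odd (negPf me) mul1r.
move=> leXY; have : 0 <= c * (Y - X) by rewrite mulr_ge0 ?subr_ge0 // ltW.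
lra.
Qed.

(** As in the even case [u2 > 0], so the second value must vanish. But |u1 + b u2| <= u1 + a u2 and
    |b| <= a give bY <= aX, which makes that value at least 1. *)
Lemma no_solution_odd_ge0 (R : realFieldType) (m : nat) (c a b u1 u2 : R) :
    0 < c -> b < a -> 0 <= a + b ->
    let X := (u1 + a * u2) ^+ m in let Y := (u1 + b * u2) ^+ m in
  compl u1 (c * (X - Y) - 1) -> ~ compl u2 (c * (a * X - b * Y) + 1).
Proof.
move=> c0 ltba ab X Y C1 C2.
have [u10 F1ge _] := C1; have [u20 _ _] := C2.
have u2pos : 0 < u2.
  rewrite lt_neqAle u20 andbT; apply/eqP => E.
  by move: F1ge; rewrite /X /Y -E !mulr0 subrr mulr0; lra.
have F2E := compl_pos C2 u2pos.
have le : `|u1 + b * u2| <= u1 + a * u2.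
  have h1 : 0 <= (a - b) * u2 by apply: mulr_ge0 => //; lra.
  have h2 : 0 <= (a + b) * u2 by apply: mulr_ge0 => //; lra.
  by rewrite ler_norml; apply/andP; split; lra.
have bY : b * Y <= a * X.
  rewrite (le_trans (ler_norm _)) // normrM ler_pM ?ler_norm_X //.
  by rewrite ler_norml; apply/andP; split; lra.
have : 0 <= c * (a * X - b * Y) by rewrite mulr_ge0 ?subr_ge0 // ltW.
lra.
Qed.

(** Odd powers are increasing, so X >= Y and the first value is at least 1, which forces [u1 = 0].
    Then |a| <= -b and the even exponent [m.+1] make the second value at most -1. *)
Lemma no_solution_odd_le0 (R : realFieldType) (m : nat) (c a b u1 u2 : R) :
    odd m -> 0 < c -> b < a -> a + b <= 0 ->
    let X := (u1 + a * u2) ^+ m in let Y := (u1 + b * u2) ^+ m in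
  compl u1 (c * (X - Y) + 1) -> ~ compl u2 (c * (a * X - b * Y) - 1).
Proof.
move=> mo c0 ltba ab X Y C1 C2.
have [u10 F1ge _] := C1; have [u20 F2ge _] := C2.
have [u1pos|u1le] := ltrP 0 u1.
  have F1E := compl_pos C1 u1pos.
  have leYX : Y <= X by apply: ler_Xodd => //; rewrite lerD2l ler_wpM2r // ltW.
  have : 0 <= c * (X - Y) by rewrite mulr_ge0 ?subr_ge0 // ltW.
  lra.
have u1E : u1 = 0 by apply/le_anti; rewrite u1le.
move: F2ge; rewrite /X /Y u1E !add0r !exprMn !mulrA -!exprS -mulrBl.
have le : `|a| <= - b by rewrite ler_norml; apply/andP; split; lra.
have ab_m : a ^+ m.+1 <= b ^+ m.+1.
  rewrite (le_trans (ler_norm _)) // (le_trans (ler_norm_X _ le)) //.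
  by rewrite (exprNn b) -signr_odd /= mo mul1r.
have : 0 <= c * ((b ^+ m.+1 - a ^+ m.+1) * u2 ^+ m).
  by rewrite !mulr_ge0 ?exprn_ge0 ?subr_ge0 // ltW.
lra.
Qed.

Lemma no_solution_normalized (R : realFieldType) (m : nat) (c a b : R) :
    (0 < m)%N -> 0 < c * (a - b) ->
  exists q1 q2 : R, forall u1 u2 : R,
    let X := (u1 + a * u2) ^+ m in let Y := (u1 + b * u2) ^+ m in
  compl u1 (c * (X - Y) + q1) -> ~ compl u2 (c * (a * X - b * Y) + q2).
Proof.
move=> m0.
(* Exchanging the two summands replaces [(c, a, b)] by [(- c, b, a)] and preserves [c * (a - b)]. *)
wlog c0 : c a b / 0 < c => [hw h|].
  have [c0|c0|c0] := ltgtP c 0; last by rewrite c0 mul0r ltxx in h.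
    have [||q1 [q2 Hq]] := hw (- c) b a; [lra|lra|].
    exists q1, q2 => u1 u2 X Y C1 C2; apply: (Hq u1 u2).
      by rewrite mulNr -mulrN opprB.
    by rewrite mulNr -mulrN opprB.
  exact: hw.
rewrite pmulr_rgt0 // subr_gt0 => ltba.
have [mo|me] := boolP (odd m); last first.
  by exists (- (1 + `|a|)^-1), 1 => u1 u2 X Y; apply: no_solution_even.
have [ab|ab] := lerP 0 (a + b).
  by exists (-1), 1 => u1 u2 X Y; apply: no_solution_odd_ge0.
by exists 1, (-1) => u1 u2 X Y; apply: no_solution_odd_le0 => //; apply: ltW.
Qed.

(** The hypotheses give the value of the form at e_1 as (0, positive). This forces [a1] and [b1] to
    be nonzero, and dividing by them yields the normalized system with c = alpha a1^(m+1) and slopes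
    [a2 / a1], [b2 / b1]. *)
Lemma no_solution (R : realFieldType) (m : nat) (alpha a1 a2 beta b1 b2 : R) :
    (0 < m)%N -> alpha * a1 ^+ m * a1 + beta * b1 ^+ m * b1 = 0 ->
    0 < alpha * a1 ^+ m * a2 + beta * b1 ^+ m * b2 ->
  exists q1 q2 : R, forall u1 u2 : R,
    let X := alpha * (a1 * u1 + a2 * u2) ^+ m in
    let Y := beta * (b1 * u1 + b2 * u2) ^+ m in
  compl u1 (X * a1 + Y * b1 + q1) -> ~ compl u2 (X * a2 + Y * b2 + q2).
Proof.
move=> m0 E0 pos.
have Pa : alpha * a1 ^+ m * a1 != 0.
  apply/eqP => Za; have Zb : beta * b1 ^+ m * b1 = 0 by lra.
  (* Positivity of [m] enters here: [y = 0] must imply [y ^+ m = 0]. *)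
  have K (x y : R) : x * y ^+ m * y = 0 -> x * y ^+ m = 0.
    move/eqP; rewrite mulf_eq0 => /orP[/eqP//|/eqP->].
    by rewrite expr0n gtn_eqF // mulr0.
  by move: pos; rewrite (K _ _ Za) (K _ _ Zb) !mul0r addr0 ltxx.
have a10 : a1 != 0 by apply: contraNneq Pa => ->; rewrite mulr0.
have b10 : b1 != 0.
  by apply: contraNneq Pa => b0; move: E0; rewrite b0 mulr0 addr0 => ->.
have Eb : beta * b1 ^+ m = - (alpha * a1 ^+ m * a1) / b1.
  by apply: (canRL (mulfK b10)); lra.
have [|q1 [q2 Hq]] := @no_solution_normalized R m (alpha * a1 ^+ m * a1)
   (a2 / a1) (b2 / b1) m0.
  suff -> : alpha * a1 ^+ m * a1 * (a2 / a1 - b2 / b1) =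
    alpha * a1 ^+ m * a2 + beta * b1 ^+ m * b2 by [].
  by rewrite Eb; field; rewrite a10 b10.
exists q1, q2 => u1 u2 X Y C1 C2.
have XE : X = alpha * a1 ^+ m * (u1 + a2 / a1 * u2) ^+ m.
  rewrite /X -(mulrA alpha) -exprMn; congr (_ * _ ^+ _).
  by field.
have YE : Y = - (alpha * a1 ^+ m * a1) / b1 * (u1 + b2 / b1 * u2) ^+ m.
  rewrite -Eb /Y -(mulrA beta) -exprMn; congr (_ * _ ^+ _).
  by field.
apply: (Hq u1 u2).
  by move: C1; congr (compl _ (_ + _)); rewrite XE YE; field.
by move: C2; congr (compl _ (_ + _)); rewrite XE YE; field; rewrite a10 b10.
Qed.

(** Cramer's rule is applied twice: first to get [X = Y = 0], so that both linear forms vanish, then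
    to those forms. *)
Lemma binary_form_grad_eq0 (R : fieldType) (m : nat)
    (alpha a1 a2 beta b1 b2 u1 u2 : R) :
    alpha != 0 -> beta != 0 -> a1 * b2 - a2 * b1 != 0 ->
    let X := alpha * (a1 * u1 + a2 * u2) ^+ m in
    let Y := beta * (b1 * u1 + b2 * u2) ^+ m in
  X * a1 + Y * b1 = 0 -> X * a2 + Y * b2 = 0 -> u1 = 0 /\ u2 = 0.
Proof.
move=> al0 be0 D0 X Y E1 E2.
have X0 : a1 * u1 + a2 * u2 = 0.
  suff /eqP : X * (a1 * b2 - a2 * b1) = 0.
    rewrite !mulf_eq0 (negPf al0) (negPf D0) orbF expf_eq0.
    by case/andP=> _ /eqP.
  by transitivity (b2 * (X * a1 + Y * b1) - b1 * (X * a2 + Y * b2));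
    [ring | rewrite E1 E2; ring].
have Y0 : b1 * u1 + b2 * u2 = 0.
  suff /eqP : Y * (a1 * b2 - a2 * b1) = 0.
    rewrite !mulf_eq0 (negPf be0) (negPf D0) orbF expf_eq0.
    by case/andP=> _ /eqP.
  by transitivity (a1 * (X * a2 + Y * b2) - a2 * (X * a1 + Y * b1));
    [ring | rewrite E1 E2; ring].
split; apply: (mulIf D0); rewrite mul0r.
  by transitivity (b2 * (a1 * u1 + a2 * u2) - a2 * (b1 * u1 + b2 * u2));
    [ring | rewrite X0 Y0; ring].
by transitivity (a1 * (b1 * u1 + b2 * u2) - b1 * (a1 * u1 + a2 * u2));
    [ring | rewrite X0 Y0; ring].
Qed.

(** * Contraction of sums of tensor powers, and TCP by coordinates *)

Lemma sum_tuple_prod (R : comNzRingType) (m n : nat) (f : 'I_n -> R) :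
  \sum_(t : m.-tuple 'I_n) \prod_(k < m) f (tnth t k) = (\sum_(i < n) f i) ^+ m.
Proof.
rewrite -[in RHS](card_ord m) -prodr_const bigA_distr_bigA.
rewrite (reindex (fun g : {ffun 'I_m -> 'I_n} => [tuple g k | k < m])) /=.
  by apply: eq_bigr => g _; apply: eq_bigr => k _; rewrite tnth_mktuple.
exists (fun t : m.-tuple 'I_n => [ffun k => tnth t k]) => [g _|t _].
  by apply/ffunP=> k; rewrite ffunE tnth_mktuple.
by apply: eq_from_tnth => k; rewrite tnth_mktuple ffunE.
Qed.

Lemma tensor_app_decomp (R : realType) (m n r : nat) (mu : 'I_r -> R)
    (w : 'I_r -> 'cV[R]_n) (u : 'cV[R]_n) (i : 'I_n) :
  tensor_app [ffun t => \sum_(j < r) mu j * tensor_pow m.+1 (w j) t] u i 0 =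
  \sum_(j < r) mu j * (\sum_(k < n) w j k 0 * u k 0) ^+ m * w j i 0.
Proof.
rewrite mxE.
transitivity (\sum_(t : m.-tuple 'I_n) \sum_(j < r) mu j * w j i 0 *
    \prod_(k < m) (w j (tnth t k) 0 * u (tnth t k) 0)).
  apply: eq_bigr => t _; rewrite ffunE mulr_suml; apply: eq_bigr => j _.
  rewrite ffunE big_ord_recl tnth0 big_split /= !mulrA; congr (_ * _ * _).
  by apply: eq_bigr => k _; rewrite tnthS.
rewrite exchange_big; apply: eq_bigr => j _ /=.
by rewrite -mulr_sumr (sum_tuple_prod _ (fun k => w j k 0 * u k 0)) mulrAC.
Qed.

Lemma tensor_powZ (R : realType) (m n : nat) (c : R) (w : 'cV[R]_n)
    (t : m.-tuple 'I_n) :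
  tensor_pow m (c *: w) t = c ^+ m * tensor_pow m w t.
Proof.
have -> : c ^+ m = \prod_(k < m) c by rewrite prodr_const card_ord.
rewrite !ffunE -big_split /=.
by apply: eq_bigr => k _; rewrite mxE.
Qed.

Lemma ord2_cover (i j k : 'I_2) : i != j -> (k == i) || (k == j).
Proof.
by case: i j k => [[|[|[]]]//?] [[|[|[]]]//?] [[|[|[]]]//?].
Qed.

Lemma sum_ord2 (V : nmodType) (f : 'I_2 -> V) (i j : 'I_2) :
  i != j -> \sum_(k < 2) f k = f i + f j.
Proof.
move=> ij; rewrite (bigD1 i) //= (bigD1 j) 1?eq_sym //= big1 ?addr0 // => k.
by case/andP=> /negPf ki /negPf kj; have := ord2_cover k ij; rewrite ki kj.
Qed.

(** A sum of nonnegative products vanishes only if each product does. *)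
Lemma TCP_solution_compl (R : realType) (m : nat) (A : tensor R m.+1 2)
    (q u : 'cV[R]_2) :
  TCP_solution A q u <-> forall i, compl (u i 0) ((tensor_app A u + q) i 0).
Proof.
set v := _ + q; have dotE : (u^T *m v) 0 0 = \sum_i u i 0 * v i 0.
  by rewrite mxE; apply: eq_bigr => k _; rewrite mxE.
split=> [[u0 v0 /matrixP/(_ 0 0)]|C].
  rewrite dotE mxE => /eqP; rewrite psumr_eq0 => [/allP H i|i _].
    by split=> //; apply/eqP/H; rewrite mem_index_enum.
  exact: mulr_ge0.
split=> [i|i|]; [by case: (C i)|by case: (C i)|].
apply/matrixP=> i j; rewrite !ord1 dotE mxE big1 // => k _.
by case: (C k).
Qed.

(** * Two-term decompositions that do not collapse to one term *)

Section RankTwo.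
Variables (R : realType) (m : nat) (mu0 mu1 : R) (w0 w1 : 'cV[R]_2).
Variable A : tensor R m.+1 2.
Hypothesis AE : forall t,
  A t = mu0 * tensor_pow m.+1 w0 t + mu1 * tensor_pow m.+1 w1 t.

Lemma tensor_app_rank2 (u : 'cV[R]_2) (i j k : 'I_2) : i != j ->
  tensor_app A u k 0 =
    mu0 * (w0 i 0 * u i 0 + w0 j 0 * u j 0) ^+ m * w0 k 0 +
    mu1 * (w1 i 0 * u i 0 + w1 j 0 * u j 0) ^+ m * w1 k 0.
Proof.
move=> ij; pose mu (l : 'I_2) := if l == 0 then mu0 else mu1.
pose w (l : 'I_2) := if l == 0 then w0 else w1.
have -> : A = [ffun t => \sum_(l < 2) mu l * tensor_pow m.+1 (w l) t].
  by apply/ffunP=> t; rewrite AE [RHS]ffunE (@sum_ord2 _ _ 0 1).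
by rewrite tensor_app_decomp (@sum_ord2 _ _ 0 1) // !(sum_ord2 _ ij).
Qed.

Hypothesis not_rank1 : ~ sym_decomposable A 1.

Let not_pow (c : R) (z : 'cV[R]_2) : ~ forall t, A t = c * tensor_pow m.+1 z t.
Proof.
move=> E; apply: not_rank1; exists (fun=> c), (fun=> z).
by apply/ffunP=> t; rewrite ffunE big_ord1.
Qed.

Let not_proportional (c0 c1 : R) (z : 'cV[R]_2) :
  ~ (w0 = c0 *: z /\ w1 = c1 *: z).
Proof.
case=> E0 E1; apply: (@not_pow (mu0 * c0 ^+ m.+1 + mu1 * c1 ^+ m.+1) z) => t.
by rewrite AE E0 E1 !tensor_powZ !mulrA -mulrDl.
Qed.

(** A tensor of order one is a vector, hence a single first power. *)
Lemma order_gt1 : (0 < m)%N.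
Proof.
rewrite lt0n; apply/eqP => m0.
have powE (z : 'cV[R]_2) t : tensor_pow m.+1 z t = z (tnth t ord0) 0.
  rewrite ffunE big_ord_recl big1 ?mulr1 // => -[k lt_km] _.
  by exfalso; rewrite m0 in lt_km.
apply: (@not_pow 1 (mu0 *: w0 + mu1 *: w1)) => t.
by rewrite AE !powE !mxE mul1r.
Qed.

Lemma rank2_mu0_neq0 : mu0 != 0.
Proof.
by apply/eqP => E; apply: (@not_pow mu1 w1) => t; rewrite AE E mul0r add0r.
Qed.

Lemma rank2_mu1_neq0 : mu1 != 0.
Proof.
by apply/eqP => E; apply: (@not_pow mu0 w0) => t; rewrite AE E mul0r addr0.
Qed.

(** A zero determinant makes [w0] and [w1] multiples of one vector, so the two powers merge into
    one. *)
Lemma rank2_det_neq0 (i j : 'I_2) : i != j ->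
  w0 i 0 * w1 j 0 - w0 j 0 * w1 i 0 != 0.
Proof.
move=> ij; apply/eqP => D.
have ext (x y : 'cV[R]_2) : x i 0 = y i 0 -> x j 0 = y j 0 -> x = y.
  move=> Ei Ej; apply/matrixP => k l; rewrite (ord1 l).
  by have /orP[/eqP->|/eqP->] := ord2_cover k ij.
have [Zi|Ni] := eqVneq (w0 i 0) 0; last first.
  apply: (@not_proportional 1 (w1 i 0 / w0 i 0) w0); split; rewrite ?scale1r //.
  apply: ext; rewrite mxE ?divfK //.
  by apply: (mulfI Ni); rewrite -[LHS](subrK (w0 j 0 * w1 i 0)) D; field.
have [Zj|Nj] := eqVneq (w0 j 0) 0; last first.
  apply: (@not_proportional 1 (w1 j 0 / w0 j 0) w0); split; rewrite ?scale1r //.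
  apply: ext; rewrite mxE ?divfK // Zi mulr0.
  move/eqP: D; rewrite Zi mul0r sub0r oppr_eq0 mulf_eq0 (negPf Nj).
  by move/eqP.
apply: (@not_proportional 0 1 w1); split; rewrite ?scale1r // scale0r.
by apply: ext; rewrite mxE.
Qed.

Lemma TCP0_pos_not_Q (u : 'cV[R]_2) (i j : 'I_2) : i != j ->
  TCP_solution A 0 u -> 0 < u i 0 -> ~ Q_tensor A.
Proof.
move=> ij /TCP_solution_compl C ui hQ.
move: (C i) (C j); rewrite addr0 => Ci Cj.
have Fi := compl_pos Ci ui.
(* Otherwise the whole contraction vanishes at [u], which forces [u = 0]. *)
have Fj : 0 < tensor_app A u j 0.
  have [_ Fj0 _] := Cj; rewrite lt_neqAle Fj0 andbT; apply/eqP => Fj.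
  move: Fi (esym Fj); rewrite !(tensor_app_rank2 _ _ ij) => Ei Ej.
  have [ui0 _] := binary_form_grad_eq0
    rank2_mu0_neq0 rank2_mu1_neq0 (rank2_det_neq0 ij) Ei Ej.
  by rewrite ui0 ltxx in ui.
have uj : u j 0 = 0.
  by have [_ _ /eqP] := Cj; rewrite mulf_eq0 (gt_eqF Fj) orbF => /eqP.
(* Since [u] is a positive multiple of e_i, homogeneity transfers the signs to A e_i^m, giving the
   hypotheses of [no_solution] with [i], [j] in the roles of 1, 2. *)
have FE k : tensor_app A u k 0 =
    (u i 0) ^+ m * (mu0 * w0 i 0 ^+ m * w0 k 0 + mu1 * w1 i 0 ^+ m * w1 k 0).
  by rewrite (tensor_app_rank2 _ _ ij) uj !mulr0 !addr0 !exprMn; ring.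
have uim : 0 < u i 0 ^+ m by apply: exprn_gt0.
move: Fi Fj; rewrite !FE => /eqP.
rewrite mulf_eq0 (gt_eqF uim) pmulr_rgt0 //= => /eqP Ei Ej.
have [q1 [q2 Hq]] := no_solution order_gt1 Ei Ej.
have [v /TCP_solution_compl Cv] :=
  hQ (\col_k (if k == i then q1 else q2)).
move: (Cv i) (Cv j); rewrite !mxE eqxx [j == i]eq_sym (negPf ij).
have := tensor_app_rank2 v _ ij; rewrite /tensor_app => TE.
move: (TE i) (TE j); rewrite !mxE => -> -> Ci' Cj'.
exact: (Hq _ _ Ci' Cj').
Qed.

Lemma Q_R0_rank2 : Q_tensor A -> R0_tensor A.
Proof.
move=> hQ u; split=> [sol|->]; last first.
  apply/TCP_solution_compl => i; rewrite addr0.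
  rewrite (@tensor_app_rank2 _ 0 1) // !mxE.
  by rewrite !mulr0 addr0 expr0n gtn_eqF ?order_gt1 // !mulr0 !mul0r addr0;
    split; rewrite ?mulr0.
apply/matrixP => k l; rewrite (ord1 l) mxE; apply/eqP.
have [u0 _ _] := sol.
apply/negPn/negP => uk; have {}uk : 0 < u k 0 by rewrite lt_neqAle eq_sym uk u0.
(* In ['I_2], [1 - k] is the other index. *)
have kj : k != 1 - k by case: k {uk} => [[|[|[]]]].
exact: (TCP0_pos_not_Q kj sol uk hQ).
Qed.

End RankTwo.

Theorem theorem7 (R : realType) (m : nat) (A : tensor R m.+1 2)
    (hsym : symmetric_tensor A) (hrank : sym_rank_eq A 2)
    (hQ : Q_tensor A) : R0_tensor A.
Proof.
have [[mu [w AE]] rmin] := hrank.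
apply: (@Q_R0_rank2 _ _ (mu 0) (mu 1) (w 0) (w 1)) => // [t|/rmin//].
by rewrite AE [LHS]ffunE(@sum_ord2 _ _ 0 1).
Qed.
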